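(* Let $\tau$ be a signature with $$\{;,\mathsf{d},\mathsf{r}\}\subseteq\tau\subseteq\{;,\mathsf{d},\mathsf{a},\mathsf{r},\mathsf{fix},0,1'\}$$ or with $$\{;,\mathsf{a},\mathsf{r},\sqcup\}\subseteq\tau\subseteq\{;,\mathsf{d},\mathsf{a},\mathsf{r},\mathsf{fix},\sqcup,{}^{\uparrow},0,1'\}.$$ Every finite, representable $\tau$-algebra $\mathscr S=(S,\tau)$ is representable over a base of size at most $|S|^{|S|+1}$.
   Context: A (unary) function on a set $X$ is a partial map $f\colon X\to X$, identified with its graph. Operations on functions on $X$: composition $f;g=\{(x,y)\mid \exists z\,((x,z)\in f\ \&\ (z,y)\in g)\}$; domain $\mathsf{d}(f)=\{(x,x)\mid \exists y\,(x,y)\in f\}$; range $\mathsf{r}(f)=\{(y,y)\mid\exists x\,(x,y)\in f\}$; antidomain $\mathsf{a}(f)=\{(x,x)\mid x\in X\ \&\ \forall y\,(x,y)\notin f\}$; fixset $\mathsf{fix}(f)=\{(x,x)\mid (x,x)\in f\}$; preferential union $f\sqcup g$, which at $x$ equals $f(x)$ if $f(x)$ is defined and $g(x)$ otherwise; maximum iterate $f^{\uparrow}=\bigcup_{n<\omega}f^n;\mathsf{a}(f)$ with $f^0$ the identity on $X$; constants $0=\varnothing$ and $1'=\{(x,x)\mid x\in X\}$. A $\tau$-algebra of functions on the base $X$ is a family of functions on $X$ closed under the operations in $\tau$ as just defined, with those operations. A $\tau$-algebra is representable (over a base $X$) if it is isomorphic to a $\tau$-algebra of functions (on the base $X$). 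*)

(* Defs.v *)
From mathcomp Require Import all_boot all_classical.
Set Implicit Arguments.
Unset Strict Implicit.
Unset Printing Implicit Defensive.

Local Open Scope classical_set_scope.

Section Graphs.
Variable X : Type.

(* Partial maps on X are handled through their graphs; the operations are
   defined on all binary relations, and functionality is imposed on the members
   of an algebra of functions (see [representable_over] below). *)
Definition graph : Type := set (X * X).

Definition functional (f : graph) : Prop := is_fun (fun x y => f (x, y)).

Implicit Types f g : graph.

(* Composition is in diagrammatic order: f first, then g. This is the opposite
   of the order of MathComp's relation notation [f \; g]. *)
Definition gcomp f g : graph :=
  [set p | exists z, f (p.1, z) /\ g (z, p.2)].

Definition gdom f : graph := [set p | p.1 = p.2 /\ exists y, f (p.1, y)].

Definition gran f : graph := [set p | p.1 = p.2 /\ exists x, f (x, p.2)].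

Definition gantidom f : graph := [set p | p.1 = p.2 /\ forall y, ~ f (p.1, y)].

Definition gfix f : graph := [set p | p.1 = p.2 /\ f p].

Definition gpref f g : graph :=
  [set p | f p \/ (forall y, ~ f (p.1, y)) /\ g p].

Definition gpow f (n : nat) : graph := iter n (gcomp f) diagonal.

Definition gmaxiter f : graph := \bigcup_n gcomp (gpow f n) (gantidom f).

End Graphs.

Inductive symbol : Type :=
  Comp | Dom | Antidom | Ran | Fix | Pref | MaxIter | Zero | One.

Definition arity (o : symbol) : nat :=
  match o with
  | Comp | Pref => 2
  | Dom | Antidom | Ran | Fix | MaxIter => 1
  | Zero | One => 0
  end.

Definition graph_op (X : Type) (o : symbol) :
    ('I_(arity o) -> graph X) -> graph X :=
  match o with
  | Comp => fun t => gcomp (t ord0) (t ord_max)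
  | Dom => fun t => gdom (t ord0)
  | Antidom => fun t => gantidom (t ord0)
  | Ran => fun t => gran (t ord0)
  | Fix => fun t => gfix (t ord0)
  | Pref => fun t => gpref (t ord0) (t ord_max)
  | MaxIter => fun t => gmaxiter (t ord0)
  | Zero => fun=> set0
  | One => fun=> diagonal
  end.

Section Algebras.
Variable tau : set symbol.

Definition algebra (S : Type) : Type :=
  forall o, tau o -> ('I_(arity o) -> S) -> S.

Definition isomorphic (S T : Type) (A : algebra S) (B : algebra T) : Prop :=
  exists h : S -> T, bijective h /\
    forall o (ho : tau o) (t : 'I_(arity o) -> S),
      h (A o ho t) = B o ho (fun i => h (t i)).

Definition op_closed (X : Type) (F : set (graph X)) : Prop :=
  forall o, tau o -> forall t : 'I_(arity o) -> graph X,
    (forall i, F (t i)) -> F (graph_op t).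

Definition function_algebra (X : Type) (F : set (graph X)) (cl : op_closed F) :
    algebra {f : graph X | F f} :=
  fun o ho t => exist F (graph_op (fun i => sval (t i)))
                  (cl o ho _ (fun i => svalP (t i))).

Definition representable_over (S : Type) (A : algebra S) (X : Type) : Prop :=
  exists (F : set (graph X)) (cl : op_closed F),
    F `<=` @functional X /\ isomorphic A (function_algebra cl).

Definition representable (S : Type) (A : algebra S) : Prop :=
  exists X : Type, representable_over A X.

End Algebras.

(* Main.v *)
Require Import Defs.
From mathcomp Require Import all_boot all_classical zify.

(** Let [S] act on [X] by partial functions. Since [dom s] fixes every point
    where [s] is defined, a point [x] lying in some domain belongs to its own
    orbit [{s(x) | s in S}], which has at most [n = |S|] points. So [n] names,
    for which the elements of [S] themselves serve, are enough to name the
    points of the orbit injectively. Given such a naming [c], record [x] by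
    its code, the partial function [s |-> c (s x)] from [S] to [S]. The codes
    are the new base, and [f] sends a code [phi] on which it is defined to the
    shifted code [s |-> phi (f;s)]; thus if [phi] codes [(x, c)], then its
    image codes [(f x, c)] ([shift_tracks]).

    Codes of [x] and [y] under one naming of the orbit of [x] differ if [y] is
    another point of that orbit ([code_color], [names_inj]). Hence a code
    remembers whether [f x = x], which preserves fixsets, and two elements of
    [S] that act differently at [x] also do so at the codes of [x]
    ([shift_inj]). Composition, domain, antidomain, preferential union and
    maximum iterate only follow the orbit of [x] and are preserved for free.
    Range is the delicate operation, as it looks backwards: if [x = f z], a
    code of [x] must be the image of a code of [z]. It is, because the orbit
    of [x] lies in the orbit of [z], so that a naming of the former extends to
    the latter: the orbit of [z] also has at most [n] points and there are [n]
    names ([names_pull]).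

    No code is nowhere defined, so there are at most [(n+1)^n - 1] codes, and
    this is at most [n^(n+1)] ([leq_expSn], [card_base]). *)

Set Implicit Arguments.
Unset Strict Implicit.
Unset Printing Implicit Defensive.

Local Open Scope classical_set_scope.

(** * Counting and naming in finite sets *)

(** The exponent on the left is bounded by the base so that an induction
    applies: passing from [k] to [k+1] multiplies by [n+1], and the excess
    [k n^k + n] is at most [n^(k+1)] as long as [k < n]. *)
Lemma leq_expSn n : n.+1 ^ n <= (n ^ n.+1).+1.
Proof.
suff H k : k <= n -> n.+1 ^ k <= (k * n ^ k).+1 by rewrite expnS H.
elim: k => [//|k IHk] lt_kn.
have step : k * n ^ k + n <= n ^ k.+1.
  case: k {IHk} lt_kn => [|k] lt_kn; first by rewrite expn1.
  have n_gt0 : 0 < n by apply: leq_trans lt_kn.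
  have le_n : n <= n ^ k.+1 by rewrite expnS leq_pmulr ?expn_gt0 ?n_gt0.
  have : k.+2 * n ^ k.+1 <= n * n ^ k.+1 by rewrite leq_mul2r lt_kn orbT.
  by rewrite -expnS mulSn; lia.
have le_k := leq_mul (leqnn n.+1) (IHk (ltnW lt_kn)).
apply: leq_trans (_ : n.+1 * (k * n ^ k).+1 <= _); first by rewrite expnS.
rewrite mulSn mulnS mulnCA -expnS mulSn; lia.
Qed.

(** The points of [b] are named one after the other: as long as one is left,
    fewer than [#|T|] names are in use. *)
Lemma extend_injective_on (X : eqType) (T : finType) (a b : seq X)
    (c : X -> T) :
  uniq (a ++ b) -> size (a ++ b) <= #|T| -> {in a &, injective c} ->
  exists c', {in a, c' =1 c} /\ {in a ++ b &, injective c'}.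
Proof.
elim: b a c => [|x b IHb] a c Uab leab injc; first by exists c; rewrite cats0.
have [t] : exists t, t \notin map c a.
  apply/existsP; apply: contraLR leab; rewrite negb_exists => /forallP allT.
  rewrite -ltnNge size_cat /= addnS ltnS.
  apply: leq_trans (leq_addr _ _); rewrite -(size_map c).
  apply: leq_trans (card_size _); apply/subset_leq_card/fintype.subsetP => t _.
  by have := allT t; rewrite negbK.
move=> t_fresh; pose c1 z := if z == x then t else c z.
have x_a : x \notin a.
  by move: Uab; rewrite cat_uniq /= negb_or => /and3P[_ /andP[]].
have c1a : {in a, c1 =1 c}.
  by move=> z za; rewrite /c1; case: eqP => // eq_zx; rewrite -eq_zx za in x_a.
have inj1 : {in rcons a x &, injective c1}.
  move=> y z; rewrite !mem_rcons !inE.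
  case/predU1P=> [->|ya]; case/predU1P=> [->|za] //.
  - rewrite (c1a z za) /c1 eqxx => t_eq.
    by case/negP: t_fresh; rewrite t_eq map_f.
  - rewrite (c1a y ya) /c1 eqxx => t_eq.
    by case/negP: t_fresh; rewrite -t_eq map_f.
  - by rewrite !c1a //; apply: injc.
case: (IHb (rcons a x) c1); rewrite ?cat_rcons // => c' [c'c1 injc'].
exists c'; split=> // z za.
by rewrite c'c1 ?c1a // mem_rcons inE za orbT.
Qed.

(** * Representations as injective homomorphisms into graphs *)

(** The image of an injective homomorphism is closed under the operations,
    so that a representation can be given without naming that image. *)
Lemma representable_overP (tau : set symbol) (S : Type) (A : algebra tau S)
    (X : Type) :
  representable_over A X <->
  exists R : S -> graph X,
    [/\ injective R, forall s, functional (R s) &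
        forall o (ho : tau o) t, R (A o ho t) = graph_op (fun i => R (t i))].
Proof.
split=> [[F [cl [Ffun [h [bij_h hA]]]]]|[R [injR Rfun RA]]].
  exists (fun s => sval (h s)); split=> [s t eq_st|s|o ho t].
  - apply: (bij_inj bij_h); apply: eq_sig_hprop eq_st => f.
    exact: Prop_irrelevance.
  - exact/Ffun/svalP.
  - by rewrite hA.
have cl : op_closed tau (range R).
  move=> o ho t Rt; exists (A o ho (fun i => sval (cid2 (Rt i)))) => //.
  by rewrite RA; congr graph_op; apply/funext=> i; case: cid2.
exists (range R), cl; split; first by move=> _ [s _ <-].
pose h s : {f | range R f} := exist _ (R s) (ex_intro2 _ _ s I erefl).
exists h; split; last by move=> o ho t; apply: eq_exist; rewrite /= RA.
apply: (@Bijective _ _ h (fun u => sval (cid2 (svalP u)))) => [s|[f Rf]].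
  by case: cid2 => /= t _ /injR.
by apply: eq_exist; case: cid2.
Qed.

(** * Coding points by injective namings of their orbits *)

Section FiniteBase.

Variables (X : choiceType) (S : finType) (R : S -> graph X).
Variables (comp : S -> S -> S) (dom ran : S -> S).
Hypothesis R_fun : forall s, functional (R s).
Hypothesis R_comp : forall s u, R (comp s u) = gcomp (R s) (R u).
Hypothesis R_dom : forall s, R (dom s) = gdom (R s).
Hypothesis R_ran : forall s, R (ran s) = gran (R s).

Implicit Types (s u : S) (x y z : X) (c : X -> S).

Definition act s x : option X :=
  if pselect (exists y, R s (x, y)) is left e then Some (sval (cid e))
  else None.

Lemma actP s x y : act s x = Some y <-> R s (x, y).
Proof.
rewrite /act; case: pselect => [e|ne]; last first.
  by split=> // Rxy; case: ne; exists y.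
case: cid => z /= Rxz; split=> [[<-]//|Rxy].
by congr Some; apply: (R_fun Rxz Rxy).
Qed.

Lemma act_comp s u x : act (comp s u) x = obind (act u) (act s x).
Proof.
case E: (act s x) => [y|] /=.
  case E' : (act u y) => [z|] /=.
    by apply/actP; rewrite R_comp; exists y; split; apply/actP.
  case E2: (act _ x) => [z|//]; move/actP: E2; rewrite R_comp => -[y' /=].
  move=> [/actP]; rewrite E => -[<-] /actP; by rewrite E'.
case E2: (act _ x) => [z|//]; move/actP: E2; rewrite R_comp => -[y' /=].
by move=> [/actP]; rewrite E.
Qed.

Lemma act_dom_id s x y : act (dom s) x = Some y -> y = x.
Proof. by move/actP; rewrite R_dom => -[]. Qed.

Lemma act_dom s x y : act s x = Some y -> act (dom s) x = Some x.
Proof. by move/actP=> sxy; apply/actP; rewrite R_dom; split=> //; exists y. Qed.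

Lemma act_ran s x y : act s x = Some y -> act (ran s) y = Some y.
Proof. by move/actP=> sxy; apply/actP; rewrite R_ran; split=> //; exists x. Qed.

Lemma act_ranP s y z : act (ran s) y = Some z -> exists x, act s x = Some y.
Proof. by move/actP; rewrite R_ran => -[/= -> [x /actP]]; exists x. Qed.

Definition orbit x : seq X := undup (pmap (act^~ x) (enum S)).

Lemma orbitP x y : reflect (exists s, act s x = Some y) (y \in orbit x).
Proof.
rewrite mem_undup mem_pmap.
by apply: (iffP mapP) => [[s _ ->]|[s <-]]; exists s; rewrite ?mem_enum.
Qed.

Lemma size_orbit x : size (orbit x) <= #|S|.
Proof.
apply: leq_trans (size_undup _) _.
by rewrite size_pmap cardE count_size.
Qed.

Lemma orbit_sub s x y : act s x = Some y -> {subset orbit y <= orbit x}.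
Proof.
move=> sxy z /orbitP[u uyz]; apply/orbitP; exists (comp s u).
by rewrite act_comp sxy.
Qed.

(** Only the points in some domain, such as all values of elements of [S], get
    a code: the other points need not lie in their own orbit, and their code
    would be nowhere defined. *)
Definition live x := exists s y, act s x = Some y.

Lemma live_orbit x : live x -> x \in orbit x.
Proof. by move=> [s [y /act_dom sx]]; apply/orbitP; exists (dom s). Qed.

Lemma live_act s x y : act s x = Some y -> live y.
Proof. by move/act_ran=> sy; exists (ran s), y. Qed.

Definition code x c : {ffun S -> option S} := [ffun s => omap c (act s x)].

Definition names x c (phi : {ffun S -> option S}) :=
  [/\ live x, {in orbit x &, injective c} & phi = code x c].

(** The code of [x] shows the name of [x] itself, at any element [dom s] with
    [s] defined at [x]. *)
Lemma code_color x y c : live x -> code x c = code y c -> c x = c y.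
Proof.
move=> [s [z /act_dom sx]] /ffunP/(_ (dom s)); rewrite !ffunE sx /=.
by case E: (act _ y) => [y'|//] /= [->]; rewrite (act_dom_id E).
Qed.

Lemma names_inj x y c phi s :
  names x c phi -> act s x = Some y -> code y c = code x c -> y = x.
Proof.
move=> [lx injc _] sxy /code_color eq_c; apply: injc; last first.
- by apply: eq_c; apply: live_act sxy.
- exact: live_orbit.
- by apply/orbitP; exists s.
Qed.

Lemma names_act x y c phi s :
  names x c phi -> act s x = Some y -> names y c (code y c).
Proof.
move=> [lx injc _] sxy; split=> //; first exact: live_act sxy.
by move=> u v uy vy; apply: injc; apply: orbit_sub sxy _ _.
Qed.

Lemma code_comp x y c s u :
  act s x = Some y -> code x c (comp s u) = code y c u.
Proof. by move=> sxy; rewrite !ffunE act_comp sxy. Qed.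

(** The step behind the preservation of ranges: every code of [s(z)] extends
    backwards to a code of [z], at the price of a change of the naming outside
    the orbit of [s(z)]. *)
Lemma names_pull x z c phi s :
  names x c phi -> act s z = Some x ->
  exists c', names z c' (code z c') /\ names x c' phi.
Proof.
move=> [lx injc ->] szx; have sub := orbit_sub szx.
pose rest := [seq y <- orbit z | y \notin orbit x].
have perm_z : perm_eq (orbit x ++ rest) (orbit z).
  rewrite uniq_perm ?undup_uniq //.
    rewrite cat_uniq !filter_uniq ?undup_uniq // andbT /=.
    by apply/hasPn=> y; rewrite mem_filter => /andP[].
  move=> y; rewrite mem_cat mem_filter.
  by case: (boolP (y \in orbit x)) => //= /sub ->.
have [||c' [c'c injc']] := @extend_injective_on _ S (orbit x) rest c _ _ injc.
- by rewrite (perm_uniq perm_z) undup_uniq.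
- by rewrite (perm_size perm_z) size_orbit.
have injz : {in orbit z &, injective c'}.
  by move=> y y'; rewrite -!(perm_mem perm_z); apply: injc'.
exists c'; split; first by split=> //; exists s, x.
split=> //; first by move=> y y' /sub yz /sub y'z; apply: injz.
apply/ffunP=> u; rewrite !ffunE; case E: (act u x) => [y|//] /=.
by rewrite c'c //; apply/orbitP; exists u.
Qed.

Lemma names_exists x (s : S) : live x -> exists c, names x c (code x c).
Proof.
move=> lx.
have [||//|c [_ injc]] :=
    @extend_injective_on _ S [::] (orbit x) (fun=> s).
- exact: undup_uniq.
- exact: size_orbit.
- by exists c; split.
Qed.

Definition base : finType :=
  {phi : {ffun S -> option S} | `[< exists x c, names x c phi >]}.

Implicit Types b : base.

Lemma baseP b : exists x c, names x c (val b).
Proof. exact/asboolP/(valP b). Qed.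

Lemma base_of x c phi : names x c phi -> exists b, names x c (val b).
Proof.
move=> nx; have phiP : `[< exists x c, names x c phi >].
  by apply/asboolP; exists x, c.
by exists (exist _ phi phiP).
Qed.

Lemma names_uniq x c b b' : names x c (val b) -> names x c (val b') -> b = b'.
Proof. by move=> [_ _ eb] [_ _ eb']; apply: val_inj; rewrite eb eb'. Qed.

Lemma card_base : #|base| <= #|S| ^ #|S|.+1.
Proof.
rewrite -ltnS; apply: leq_trans (leq_expSn _).
rewrite -(card_option S) -card_ffun card_sig.
apply: proper_card; apply/properP; split; first exact/fintype.subsetP.
exists [ffun=> None] => //; apply/negP => /asboolP[x [c]].
by move=> [[s [y sxy]] _ /ffunP/(_ s)]; rewrite !ffunE sxy.
Qed.

(** * Transfer of the operations from points to codes *)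

(** Simulation of [H] by [G] along codes: at a code of [(x, c)], the graph [G]
    moves exactly as [H] moves at [x], with the naming [c] kept. *)
Definition tracks (G : graph base) (H : graph X) := forall x c b b',
  names x c (val b) -> G (b, b') <-> exists y, H (x, y) /\ names y c (val b').

(** As every element of [base] is a code, tracking determines a graph. The
    operations are therefore preserved as soon as both sides of the
    homomorphism identity track the same graph on [X]. *)
Lemma tracks_eq G G' H : tracks G H -> tracks G' H -> G = G'.
Proof.
move=> GH G'H; apply/seteqP; split=> -[b b'] Gb; have [x [c nb]] := baseP b.
  by apply/(G'H _ _ _ _ nb)/(GH _ _ _ _ nb).
by apply/(GH _ _ _ _ nb)/(G'H _ _ _ _ nb).
Qed.

(** It refers to codes only, not to the points they come from, which is what
    makes it a partial function on [base]. *)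
Definition shift s : graph base :=
  [set p : base * base |
    val p.1 s <> None /\ forall u, val p.2 u = val p.1 (comp s u)].

Lemma shift_functional s : functional (shift s).
Proof.
move=> b b1 b2 /= [_ eq1] [_ eq2]; apply/val_inj/ffunP=> u /=.
by rewrite eq1 eq2.
Qed.

Lemma shift_tracks s : tracks (shift s) (R s).
Proof.
move=> x c b b' nx; case: (nx) => _ _ eb; rewrite /shift /= eb.
split=> [[def eq_b']|[y [/actP sxy [_ _ ->]]]]; last first.
  by split=> [|u]; rewrite ?(code_comp _ _ sxy) // ffunE sxy.
move: def; rewrite ffunE; case sxy: (act s x) => [y|//] _.
exists y; split; first exact/actP.
suff -> : val b' = code y c by apply: names_act nx sxy.
by apply/ffunP=> u; rewrite eq_b' (code_comp _ _ sxy).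
Qed.

(** A naming of the orbit of [x] is good for the orbit of [y] when [y] lies in
    the orbit of [x], so that the moves of such graphs [H] always reach
    codes. *)
Definition steps (H : graph X) := forall x y, H (x, y) -> y \in orbit x.

Lemma R_steps s : steps (R s).
Proof. by move=> x y /actP sxy; apply/orbitP; exists s. Qed.

Lemma names_orbit x y c phi :
  names x c phi -> y \in orbit x -> exists b, names y c (val b).
Proof. by move=> nx /orbitP[s sxy]; apply: base_of (names_act nx sxy). Qed.

Lemma tracks_defined G H x c b : tracks G H -> steps H -> names x c (val b) ->
  (exists b', G (b, b')) <-> (exists y, H (x, y)).
Proof.
move=> GH Hs nx; split=> [[b' /(GH _ _ _ _ nx)[y []]]|[y Hxy]].
  by exists y.
have [b' nb'] := names_orbit nx (Hs _ _ Hxy).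
by exists b'; apply/(GH _ _ _ _ nx); exists y.
Qed.

(** The graphs of domains, antidomains, ranges and fixsets restrict the
    identity, and they are tracked when membership of a point can be read off
    its code. *)
Lemma tracks_restrict (G : graph base) (H : graph X)
    (P : base -> Prop) (Q : X -> Prop) :
  (forall p, G p <-> p.1 = p.2 /\ P p.2) ->
  (forall p, H p <-> p.1 = p.2 /\ Q p.2) ->
  (forall x c b, names x c (val b) -> P b <-> Q x) -> tracks G H.
Proof.
move=> GP HQ PQ x c b b' nx; split=> [/GP/= [<- Pb]|[y [/HQ/= [<- Qx] nb']]].
  by exists x; split=> //; apply/HQ; split=> //; apply/(PQ _ _ _ nx).
by apply/GP; rewrite (names_uniq nb' nx); split=> //; apply/(PQ _ _ _ nx).
Qed.

Lemma tracks_comp G H G' H' :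
  tracks G H -> steps H -> tracks G' H' ->
  tracks (gcomp G G') (gcomp H H').
Proof.
move=> GH Hs GH' x c b b' nx; split=> [[b1 /= [Gb Gb']]|].
  have [y [Hxy ny]] := (GH _ _ _ _ nx).1 Gb.
  have [z [Hyz nz]] := (GH' _ _ _ _ ny).1 Gb'.
  by exists z; split=> //; exists y.
move=> [z [[y [/= Hxy Hyz]] nz]].
have [b1 ny] := names_orbit nx (Hs _ _ Hxy).
exists b1; split; first by apply/(GH _ _ _ _ nx); exists y.
by apply/(GH' _ _ _ _ ny); exists z.
Qed.

Lemma tracks_diag : tracks diagonal diagonal.
Proof.
by apply: (tracks_restrict (P := fun=> True) (Q := fun=> True)) => // p;
  split=> // -[].
Qed.

Lemma tracks_set0 : tracks set0 set0.
Proof. by move=> x c b b' _; split=> // -[y []]. Qed.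

Lemma tracks_dom G H : tracks G H -> steps H -> tracks (gdom G) (gdom H).
Proof.
move=> GH Hs; apply: (tracks_restrict
    (P := fun b => exists b', G (b, b')) (Q := fun x => exists y, H (x, y))).
- by move=> [b b']; split=> -[/= <-].
- by move=> [y y']; split=> -[/= <-].
- by move=> x c b; apply: tracks_defined.
Qed.

Lemma tracks_antidom G H :
  tracks G H -> steps H -> tracks (gantidom G) (gantidom H).
Proof.
move=> GH Hs; apply: (tracks_restrict
    (P := fun b => ~ exists b', G (b, b'))
    (Q := fun x => ~ exists y, H (x, y))).
- by move=> [b b']; rewrite -forallNE; split=> -[/= <-].
- by move=> [y y']; rewrite -forallNE; split=> -[/= <-].
- by move=> x c b nx; rewrite (tracks_defined GH Hs nx).
Qed.

(** If the code of [x] is the image of a code, it may also code another point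
    [y], and it is [y] that is seen to lie in the range of [s]. As [x] and [y]
    have the same code, [ran s] is defined at both, so [x] lies in the range of
    [s] too. This is why the lemma concerns the elements of [S] only, and not
    arbitrary tracked graphs. *)
Lemma tracks_ran s : tracks (gran (shift s)) (gran (R s)).
Proof.
apply: (tracks_restrict (P := fun b => exists b0, shift s (b0, b))
                        (Q := fun x => exists z, R s (z, x))) => //.
move=> x c b nx; split=> [[b0 Gb]|[z /actP szx]]; last first.
  have [c' [nz nx']] := names_pull nx szx.
  have [b0 nb0] := base_of nz.
  by exists b0; apply/(shift_tracks _ _ nb0); exists x; split=> //; apply/actP.
have [z [c' nz]] := baseP b0.
have [y [/actP szy [_ _ eby]]] := (shift_tracks s b nz).1 Gb.
case: nx => _ _ ebx; move: ebx; rewrite eby => /ffunP/(_ (ran s)).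
rewrite !ffunE (act_ran szy) /=; case E: (act _ x) => [x'|//] _.
by have [z' /actP] := act_ranP E; exists z'.
Qed.

Lemma tracks_fix G H : tracks G H -> steps H -> tracks (gfix G) (gfix H).
Proof.
move=> GH Hs; apply: (tracks_restrict
    (P := fun b => G (b, b)) (Q := fun x => H (x, x))).
- by move=> [b b']; split=> -[/= <-].
- by move=> [y y']; split=> -[/= <-].
move=> x c b nx; rewrite (GH _ _ _ _ nx); split=> [[y [Hxy ny]]|Hxx].
  have /orbitP[s sxy] := Hs _ _ Hxy.
  have eq_code : code y c = code x c by case: nx ny => _ _ <- [_ _ <-].
  by rewrite -{2}(names_inj nx sxy eq_code).
by exists x.
Qed.

Lemma tracks_pref G H G' H' :
  tracks G H -> steps H -> tracks G' H' -> tracks (gpref G G') (gpref H H').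
Proof.
move=> GH Hs GH' x c b b' nx.
have undef : (forall b1, ~ G (b, b1)) <-> (forall y, ~ H (x, y)).
  by rewrite !forallNE (tracks_defined GH Hs nx).
split=> [[/(GH _ _ _ _ nx)|[/undef nH /(GH' _ _ _ _ nx)]] [y [Hxy ny]]|].
- by exists y; split=> //; left.
- by exists y; split=> //; right.
move=> [y [[Hxy|[nH Hxy]] ny]]; first by left; apply/(GH _ _ _ _ nx); exists y.
by right; split; [apply/undef|apply/(GH' _ _ _ _ nx); exists y].
Qed.

Lemma gcomp_diagonal_l (Y : Type) (K : graph Y) : gcomp diagonal K = K.
Proof.
apply/seteqP; split=> -[p q] => [[r [pr Krq]]|Kpq]; last by exists p.
by rewrite (pr : p = r).
Qed.

Lemma gcompA (Y : Type) (K L M : graph Y) :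
  gcomp (gcomp K L) M = gcomp K (gcomp L M).
Proof.
apply/seteqP; split=> -[p q] /=.
  by move=> [r [[r' [? ?]] ?]]; exists r'; split=> //; exists r.
by move=> [r [? [r' [? ?]]]]; exists r'; split=> //; exists r.
Qed.

(** The powers are reassociated so that each composition has [R s] on its
    left: the identity, hence the zeroth power, does not satisfy [steps] at
    points outside all domains. *)
Lemma tracks_maxiter s : tracks (gmaxiter (shift s)) (gmaxiter (R s)).
Proof.
have anti := tracks_antidom (@shift_tracks s) (@R_steps s).
have iter_tracks n : tracks (gcomp (gpow (shift s) n) (gantidom (shift s)))
                            (gcomp (gpow (R s) n) (gantidom (R s))).
  elim: n => [|n IHn]; first by rewrite !gcomp_diagonal_l.
  rewrite /gpow !iterS !gcompA.
  exact: tracks_comp (@shift_tracks s) (@R_steps s) IHn.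
move=> x c b b' nx; split.
  move=> [n _ /(iter_tracks n _ _ _ _ nx) [y [Hxy ny]]].
  by exists y; split=> //; exists n.
move=> [y [[n _ Hxy] ny]]; exists n => //.
by apply/(iter_tracks n _ _ _ _ nx); exists y.
Qed.

Lemma shift_op (o : symbol) (t : 'I_(arity o) -> S) (s : S) :
  R s = graph_op (fun i => R (t i)) ->
  shift s = graph_op (fun i => shift (t i)).
Proof.
move=> Rs; apply: tracks_eq (@shift_tracks s) _; rewrite Rs.
have Ht i := @shift_tracks (t i); have Hs i := @R_steps (t i).
case: o t Rs Ht Hs => t _ Ht Hs /=.
- exact: tracks_comp.
- exact: tracks_dom.
- exact: tracks_antidom.
- exact: tracks_ran.
- exact: tracks_fix.
- exact: tracks_pref.
- exact: tracks_maxiter.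
- exact: tracks_set0.
- exact: tracks_diag.
Qed.

(** If [s] takes [x] to [y], then at a code of [x] equality of the shifts
    forces [u] to take [x] to a point [y'] with the code of [y] under the same
    naming; both points lie in the orbit of [x], so they coincide. *)
Lemma shift_inj : injective R -> injective shift.
Proof.
move=> injR.
suff sub s u : shift s = shift u -> R s `<=` R u.
  by move=> s u eq_su; apply/injR/seteqP; split; apply: sub.
move=> eq_su [x y] /actP sxy.
have lx : live x by exists s, y.
have [c nx] := names_exists s lx.
have [b nb] := base_of nx; have ny := names_act nb sxy.
have [b' nb'] := base_of ny.
have /(shift_tracks _ _ nb)[y' [/actP uxy' ny']] : shift u (b, b').
  rewrite -eq_su; apply/(shift_tracks _ _ nb).
  by exists y; split=> //; apply/actP.
have eq_code : code y c = code y' c by case: nb' ny' => _ _ <- [_ _ <-].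
have [_ injc _] := nb.
have -> : y = y'; last exact/actP.
apply: injc.
- by apply/orbitP; exists s.
- by apply/orbitP; exists u.
- by apply: code_color eq_code; apply: live_act sxy.
Qed.

End FiniteBase.

(** * The finite base *)

Theorem theorem6p3 (tau : set symbol)
  (htau :
    ([set Comp; Dom; Ran] `<=` tau /\
     tau `<=` [set Comp; Dom; Antidom; Ran; Fix; Zero; One]) \/
    ([set Comp; Antidom; Ran; Pref] `<=` tau /\
     tau `<=` [set Comp; Dom; Antidom; Ran; Fix; Pref; MaxIter; Zero; One]))
  (S : finType) (A : algebra tau S) :
  representable A ->
  exists X : finType, representable_over A X /\ (#|X| <= #|S| ^ (#|S| + 1))%N.
Proof.
move=> [X /representable_overP[R [injR Rfun RA]]].
have [comp Rcomp] : exists comp : S -> S -> S,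
    forall s u, R (comp s u) = gcomp (R s) (R u).
  have hComp : tau Comp by case: htau => -[sub _]; apply: sub => /=; tauto.
  exists (fun s u => A Comp hComp (fun i => if i == ord0 then s else u)).
  by move=> s u; rewrite RA.
have [ran Rran] : exists ran : S -> S, forall s, R (ran s) = gran (R s).
  have hRan : tau Ran by case: htau => -[sub _]; apply: sub => /=; tauto.
  by exists (fun s => A Ran hRan (fun=> s)) => s; rewrite RA.
have [dom Rdom] : exists dom : S -> S, forall s, R (dom s) = gdom (R s).
  case: htau => -[sub _].
    have hDom : tau Dom by apply: sub => /=; tauto.
    by exists (fun s => A Dom hDom (fun=> s)) => s; rewrite RA.
  (* Domain is the double antidomain. *)
  have hAnti : tau Antidom by apply: sub => /=; tauto.
  exists (fun s => A Antidom hAnti (fun=> A Antidom hAnti (fun=> s))) => s.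
  rewrite !RA /=; apply/seteqP; split=> -[x y] -[/= <-].
    move=> nn; split=> //; apply: contrapT => no_y.
    by apply: (nn x); split=> // y' sxy'; apply: no_y; exists y'.
  by move=> [z sxz]; split=> // z' [_ /(_ z)].
exists (@base {classic X} S R); split; last first.
  by rewrite addn1; apply: card_base.
apply/representable_overP; exists (@shift {classic X} S R comp); split.
- exact: (@shift_inj {classic X} S R comp dom ran).
- exact: shift_functional.
- move=> o ho t.
  exact: (@shift_op {classic X} S R comp dom ran Rfun Rcomp Rdom Rran).
Qed.
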